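(* Let $G$ be an undirected graph. (i) If every connected component of $G$ is either trivial or a complete graph (with loops), then the graph algebra $\mathbb{A}(G)$ satisfies every bracketing identity. In this case, $s_n(\mathbb{A}(G)) = 1$ for all integers $n \ge 1$. (ii) If every connected component of $G$ is either trivial, a complete graph (with loops), or a complete bipartite graph, and the last case occurs at least once, then for all $n\ge 1$ and all $t,t'\in B_n$, $\mathbb{A}(G)$ satisfies the bracketing identity $t \approx t'$ if and only if $d_{G(t)}(x_i) \equiv d_{G(t')}(x_i) \pmod{2}$ for all $i\in\{1,\dots,n\}$. In this case, $s_n(\mathbb{A}(G)) = 2^{n-2}$ for all $n \geq 2$. (iii) Otherwise $\mathbb{A}(G)$ satisfies no nontrivial bracketing identity. In this case, $s_n(\mathbb{A}(G)) = C_{n-1}$ for all integers $n \ge 1$, where $C_{n-1} = \frac{1}{n}\binom{2n-2}{n-1}$ is the Catalan number.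
   Context: A digraph is a pair $G=(V,E)$ with $V$ a nonempty (possibly infinite) set and $E\subseteq V^2$ (loops $(u,u)$ allowed). An undirected graph is a digraph with symmetric edge relation; its connected components are the subgraphs induced on the classes of the relation ''each of $u$, $v$ is reachable from the other by a walk (possibly of length $0$)''. A component is trivial if it has one vertex and no edge. A complete graph (with loops) has edge relation $V\times V$. A complete bipartite graph has a partition of $V$ into two nonempty sets $B_1,B_2$ such that $E=(B_1\times B_2)\cup(B_2\times B_1)$. Graph algebra: $\mathbb{A}(G)=(V\cup\{\infty\};\circ,\infty)$ with $\infty\notin V$, where $x\circ y=x$ if $(x,y)\in E$ and $x\circ y=\infty$ otherwise. Bracketings: $B_n$ is the set of groupoid terms obtained from the string $x_1x_2\cdots x_n$ of distinct variables (in this order) by inserting parentheses so that the product is unambiguous; $|B_n|=C_{n-1}$. A bracketing identity is an identity $t\approx t'$ with $t,t'\in B_n$ for some $n$; it is nontrivial if $t\ne t'$. $\mathbb{A}(G)$ satisfies $t\approx t'$ if $t$ and $t'$ (with the product interpreted as $\circ$) take equal values under all assignments of elements of $V\cup\{\infty\}$ to $x_1,\dots,x_n$. The associative spectrum is the sequence $s_n(\mathbb{A}(G))$, $n\ge1$, where $s_n(\mathbb{A}(G))$ is the number of distinct $n$-ary operations on $V\cup\{\infty\}$ induced by the elements of $B_n$. For $t\in B_n$, $G(t)$ is the digraph on $X_n=\{x_1,\dots,x_n\}$ in which $(x_i,x_j)$ is an edge iff $t$ has a subterm $(t_1\circ t_2)$ such that the leftmost variable of $t_1$ is $x_i$ and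 the leftmost variable of $t_2$ is $x_j$. It is a rooted directed tree with root $x_1$ (edges directed away from the root); $d_{G(t)}(x_i)$ is the depth of $x_i$, i.e. the length of the unique path from $x_1$ to $x_i$. *)

(* Defs.v *)
From HB Require Import structures.
From mathcomp Require Import all_boot finmap.
From mathcomp Require Import boolp classical_sets functions cardinality.

Set Implicit Arguments.
Unset Strict Implicit.
Unset Printing Implicit Defensive.

Local Open Scope classical_set_scope.

Section Graphs.
Variables (V : Type) (E : V -> V -> Prop).

Definition undirected : Prop := forall u v, E u v -> E v u.

Fixpoint walk (u : V) (p : seq V) : Prop :=
  if p is v :: p' then E u v /\ walk v p' else True.

Definition reachable (u v : V) : Prop := exists p, walk u p /\ last u p = v.

Definition component (C : set V) : Prop :=
  exists u, C = [set v | reachable u v /\ reachable v u].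

(* The next three predicates describe the subgraph of (V, E) induced on C. *)

Definition trivial_graph (C : set V) : Prop :=
  (exists u, C = [set u]) /\ (forall u v, C u -> C v -> ~ E u v).

Definition complete_graph (C : set V) : Prop :=
  forall u v, C u -> C v -> E u v.

Definition complete_bipartite_graph (C : set V) : Prop :=
  exists B1 B2 : set V,
    [/\ B1 !=set0, B2 !=set0, B1 `&` B2 = set0, B1 `|` B2 = C &
        forall u v, C u -> C v -> (E u v <-> (B1 u /\ B2 v) \/ (B2 u /\ B1 v))].

Definition components_trivial_or_complete : Prop :=
  forall C, component C -> trivial_graph C \/ complete_graph C.

Definition components_with_bipartite : Prop :=
  (forall C, component C ->
     [\/ trivial_graph C, complete_graph C | complete_bipartite_graph C]) /\
  (exists C, component C /\ complete_bipartite_graph C).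

(* None is the additional element oo. *)
Definition graph_mul (x y : option V) : option V :=
  match x, y with
  | Some u, Some v => if `[< E u v >] then Some u else None
  | _, _ => None
  end.

End Graphs.

Inductive term (X : Type) : Type :=
| Var of X
| App of term X & term X.

Section Terms.
Variable X : Type.
Implicit Types t : term X.

Fixpoint leaves t : seq X :=
  match t with
  | Var x => [:: x]
  | App t1 t2 => leaves t1 ++ leaves t2
  end.

Fixpoint leftmost t : X :=
  match t with
  | Var x => x
  | App t1 _ => leftmost t1
  end.

Fixpoint subterms t : seq (term X) :=
  t :: (if t is App t1 t2 then subterms t1 ++ subterms t2 else [::]).

Fixpoint eval (A : Type) (op : A -> A -> A) (t : term X) (a : X -> A) : A :=
  match t with
  | Var x => a x
  | App t1 t2 => op (eval op t1 a) (eval op t2 a)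
  end.

Definition satisfies (A : Type) (op : A -> A -> A) (t t' : term X) : Prop :=
  forall a : X -> A, eval op t a = eval op t' a.

End Terms.

(* The variable x_i (1 <= i <= n) is the element i - 1 of 'I_n. *)
Definition bracketings (n : nat) : set (term 'I_n) :=
  [set t | leaves t = enum 'I_n].

(* {classic _} only provides the choiceType structure required by fset_set;
   the set of operations is finite by finite_bracketings below. *)
Definition assoc_spectrum (A : Type) (op : A -> A -> A) (n : nat) : nat :=
  #|` fset_set [set (eval op t : {classic ('I_n -> A) -> A})
                | t in @bracketings n] |%fset.

Section TermTree.
Variable X : eqType.
Implicit Types t : term X.

Definition tree_edge t : rel X := fun x y =>
  has (fun s => if s is App t1 t2
                then (leftmost t1 == x) && (leftmost t2 == y) else false)
      (subterms t).

(* For t in bracketings n, leftmost t is the root x_1. *)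
Definition tree_path t (x : X) (p : seq X) : Prop :=
  [/\ path (tree_edge t) (leftmost t) p, uniq (leftmost t :: p)
    & last (leftmost t) p = x].

(* The default 0 is not used for t in bracketings n, see tree_path_unique. *)
Definition depth t (x : X) : nat :=
  xget 0 [set d | exists2 p, tree_path t x p & size p = d].

End TermTree.

(* (1 / n) * 'C(2n - 2, n - 1) at n = m + 1; the division is exact. *)
Definition catalan (m : nat) : nat := 'C(m.*2, m) %/ m.+1.

Lemma size_leaves X (t : term X) : 0 < size (leaves t).
Proof. by elim: t => //= t1 h1 t2 _; rewrite size_cat addn_gt0 h1. Qed.

Lemma finite_leaves X (s : seq X) : finite_set [set t | leaves t = s].
Proof.
have [m] := ubnP (size s); elim: m s => // m IHm s ltsm.
have fU : finite_set
    ((@Var X) @` [set x | s = [:: x]] `|`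
     \bigcup_(k in [set k | 0 < k < size s])
       [set App t1 t2 | t1 in [set t | leaves t = take k s]
                      & t2 in [set t | leaves t = drop k s]]).
  rewrite finite_setU; split.
    apply: finite_image; case: s {ltsm} => [|x s].
      by apply: (@sub_finite_set _ _ set0) => // x.
    by apply: (@sub_finite_set _ _ [set x]) => // y [->].
  apply: bigcup_finite => [|k /andP[k0 ks]].
    by apply: (@sub_finite_set _ _ `I_(size s)) => // k /andP[].
  apply: finite_image2; apply: IHm.
    by rewrite size_take ks; apply: leq_trans ks _.
  rewrite size_drop; apply: leq_trans (_ : size s <= m) => //.
  by rewrite ltn_subrL k0 (leq_trans _ ks).
apply: sub_finite_set fU => -[x|t1 t2] /= ts.
  by left; exists x.
right; exists (size (leaves t1)) => /=.
  by rewrite -ts size_cat size_leaves -[ltnLHS]addn0 ltn_add2l size_leaves.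
exists t1; first by rewrite -ts /= take_size_cat.
by exists t2 => //; rewrite -ts /= drop_size_cat.
Qed.

Lemma finite_bracketings n : finite_set (@bracketings n).
Proof. exact: finite_leaves. Qed.

Section TermTreeTheory.
Variable X : eqType.
Implicit Types t : term X.

Lemma leftmost_leaves t : leftmost t \in leaves t.
Proof. by elim: t => /= [x|t1 h1 t2 _]; rewrite ?inE // mem_cat h1. Qed.

Lemma tree_edge_App t1 t2 x y :
  tree_edge (App t1 t2) x y =
  [|| (leftmost t1 == x) && (leftmost t2 == y),
      tree_edge t1 x y | tree_edge t2 x y].
Proof. by rewrite /tree_edge /= has_cat. Qed.

Lemma tree_edge_leaves t x y :
  tree_edge t x y -> (x \in leaves t) && (y \in leaves t).
Proof.
elim: t => // t1 h1 t2 h2; rewrite tree_edge_App /= !mem_cat.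
case/or3P => [/andP[/eqP<- /eqP<-]|/h1/andP[-> ->]|/h2/andP[-> ->]] //;
  by rewrite ?leftmost_leaves ?orbT.
Qed.

Lemma tree_edge_root t x : uniq (leaves t) -> ~~ tree_edge t x (leftmost t).
Proof.
elim: t => // t1 h1 t2 h2 /=; rewrite cat_uniq => /and3P[u1 /hasPn d u2].
rewrite tree_edge_App (negbTE (h1 u1)) /=.
have n2 : leftmost t1 \notin leaves t2.
  by apply/negP => /d; rewrite /= leftmost_leaves.
apply/norP; split; apply/negP.
  by case/andP => _ /eqP e; rewrite -e leftmost_leaves in n2.
by move=> /tree_edge_leaves /andP[_]; apply/negP.
Qed.

Lemma tree_edge_parent t x x' y : uniq (leaves t) ->
  tree_edge t x y -> tree_edge t x' y -> x = x'.
Proof.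
elim: t => // t1 h1 t2 h2 /=; rewrite cat_uniq => /and3P[u1 /hasPn d u2].
have D z : z \in leaves t2 -> z \in leaves t1 -> False.
  by move=> /d /negP.
rewrite !tree_edge_App.
case/or3P => [/andP[/eqP<- /eqP<-]|e|e];
case/or3P => [/andP[/eqP e1 /eqP e2]|e'|e'] //.
- by case/andP: (tree_edge_leaves e') => _ /(D _ (leftmost_leaves t2)).
- by rewrite (negbTE (tree_edge_root _ u2)) in e'.
- by case/andP: (tree_edge_leaves e); rewrite -e2 => _ /(D _ (leftmost_leaves t2)).
- exact: h1.
- case/andP: (tree_edge_leaves e) => _ y1; case/andP: (tree_edge_leaves e') => _.
  by move/D => /(_ y1).
- by rewrite -e2 (negbTE (tree_edge_root _ u2)) in e.
- case/andP: (tree_edge_leaves e) => _ y1; case/andP: (tree_edge_leaves e') => _.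
  by move: y1 => /D /[apply].
- exact: h2.
Qed.

Lemma tree_path_exists t x : uniq (leaves t) -> x \in leaves t ->
  exists p, tree_path t x p.
Proof.
elim: t => [y _|t1 h1 t2 h2 /=].
  by rewrite inE => /eqP ->; exists [::].
rewrite cat_uniq mem_cat => /and3P[u1 /hasPn d u2] /orP[xt|xt].
  have [p [pp up lp]] := h1 u1 xt; exists p; split=> //.
  by apply: sub_path pp => a b ab; rewrite tree_edge_App ab orbT.
have [p [pp up lp]] := h2 u2 xt; exists (leftmost t2 :: p); split=> //.
  rewrite /= tree_edge_App !eqxx /=.
  by apply: sub_path pp => a b ab; rewrite tree_edge_App ab !orbT.
rewrite cons_uniq up andbT /=; apply/negP => H.
have : leftmost t1 \in leaves t2.
  move: H; rewrite inE => /orP[/eqP->|]; first exact: leftmost_leaves.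
  elim: p (leftmost t2) pp {up lp} => //= y p IH z /andP[zy pp].
  rewrite inE => /orP[/eqP->|]; last exact: IH pp.
  by case/andP: (tree_edge_leaves zy).
by move=> /d; rewrite /= leftmost_leaves.
Qed.

Lemma tree_path_unique t x : uniq (leaves t) -> x \in leaves t ->
  exists! p, tree_path t x p.
Proof.
move=> ut xt; have [p pP] := tree_path_exists ut xt.
exists p; split=> // q; case: pP => pp _ + [+ _].
elim/last_ind: p q x {xt} pp => [|p y IH] q x; elim/last_ind: q => [|q z _] //.
- rewrite rcons_path last_rcons => _ /= <- /andP[_ e] ze.
  by rewrite ze (negbTE (tree_edge_root _ ut)) in e.
- rewrite rcons_path last_rcons => /andP[_ e] ye _ /= ze.
  by rewrite ye -ze (negbTE (tree_edge_root _ ut)) in e.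
rewrite !rcons_path !last_rcons => /andP[pp e] yx /andP[pq e'] zx.
rewrite {}yx in e *; rewrite {}zx in e' *.
by congr rcons; apply: (IH q _ pp erefl pq); rewrite (tree_edge_parent ut e e').
Qed.

End TermTreeTheory.

(* Main.v *)
Require Import Defs.
From mathcomp Require Import all_boot.
From mathcomp Require Import finmap zify.
From mathcomp Require Import boolp classical_sets cardinality.

(** The value of a term [t] in the graph algebra, under an assignment with
    values in [V], is the value of the leftmost variable if the assignment is
    a homomorphism from the tree G(t) to the graph, and oo otherwise.  Hence
    [t] and [t'] are identified exactly when G(t) and G(t') have the same
    homomorphisms to the graph ([satisfies_tree_hom]).

    The three cases are separated by one closure property: the graph is
    [three_closed] if the ends of every walk of length 3 are adjacent.  For an
    undirected graph this holds exactly when every component is trivial,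
    complete or complete bipartite ([bipartite_three_closed],
    [three_closed_cases]); if bipartite components are excluded, the adjacency
    relation is even transitive.

    - If adjacency is transitive, a homomorphism from one tree with at least
      two vertices makes all vertices adjacent to the image of the root, hence
      to each other, so it is a homomorphism from every tree on the same
      vertices ([tree_hom_trans]).
    - If the graph is [three_closed], the ends of every walk of odd length are
      adjacent, so only the parities of the depths matter
      ([tree_hom_parity]).  Conversely a homomorphism to a single edge
      without loops at its ends reads off these parities ([parity_of_tree_hom]).
    - If the graph is not [three_closed], then for all a and b with a + 2 <= b
      some infinite walk g has nonadjacent vertices g a and g b.  Suppose that
      x is the first variable whose depths b in G(t) and c in G(t') differ,
      and that c < b.  The parent of x in G(t') comes before x, so it has
      depth a = c - 1 in both trees.  Then g composed with the depth in G(t) is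
      a homomorphism from G(t), but it sends the edge of G(t') that enters x to
      the nonadjacent pair g a, g b.  So the depths agree everywhere
      ([depth_of_tree_hom]), and the depths determine the term
      ([levels_inj]).

    For the counts, the depths of x_1, ..., x_n read in this order form a word
    that starts with 0, stays positive afterwards and increases by at most 1
    at each step; each such word belongs to exactly one bracketing.  These
    words satisfy the ballot recurrence, which gives the Catalan numbers, and
    their reductions modulo 2 are all words beginning with 0 1, because any
    word in the letters 1 and 2 that begins with 1 is allowed after the
    initial 0. *)

Set Implicit Arguments.
Unset Strict Implicit.
Unset Printing Implicit Defensive.

(** * Depth words of terms *)

Section Levels.
Variable X : Type.
Implicit Types t : term X.

(** The depths of the leaves in G(t), from left to right (see [levelsE]): the
    root of the tree of [t2] becomes a child of the root of the tree of
    [t1]. *)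
Fixpoint levels t : seq nat :=
  match t with
  | Var _ => [:: 0]
  | App t1 t2 => levels t1 ++ map succn (levels t2)
  end.

Lemma size_levels t : size (levels t) = size (leaves t).
Proof. by elim: t => //= t1 h1 t2 h2; rewrite !size_cat size_map h1 h2. Qed.

Definition climbs (d e : nat) : bool := 0 < e <= d.+1.

Lemma levels_climb t : exists2 w, levels t = 0 :: w & path climbs 0 w.
Proof.
elim: t => [x|t1 [w1 /= -> p1] t2 [w2 /= -> p2]]; first by exists [::].
exists (w1 ++ map succn (0 :: w2)) => //=; rewrite cat_path p1 /=.
by rewrite path_map; apply: sub_path p2 => d e; rewrite /= /climbs; lia.
Qed.

(** The second factor of a product starts at the last letter 1 of the word,
    because its letters other than the first are at least 2 after the shift;
    so the word determines the two factors. *)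
Lemma levels_inj t t' : leaves t = leaves t' -> levels t = levels t' -> t = t'.
Proof.
have main (u u' u2 u2' : seq nat) : size u < size u' ->
    u ++ map succn (0 :: u2) = u' ++ map succn (0 :: u2') ->
    all (leq 1) u2 -> False.
  (* The letter at position [size u'] is 1 on the right-hand side, but on the
     left-hand side it comes from the tail [u2] and is at least 2. *)
  move=> lt e /allP u2p; have := congr1 (fun s => nth 0 s (size u')) e.
  rewrite !nth_cat ltnn subnn ltnNge ltnW //=.
  case k: (size u' - size u) => [|k'] /=; first by lia.
  have ks : k' < size u2.
    by have := congr1 size e; rewrite !size_cat /= !size_map; lia.
  by rewrite (nth_map 0) // => -[e0]; have := u2p _ (mem_nth 0 ks); rewrite e0.
have pos d w : path climbs d w -> all (leq 1) w.
  by elim: w d => //= e w IH d /andP[/andP[-> _] /IH].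
elim: t t' => [x|t1 h1 t2 h2] [x'|t1' t2'] /=.
- by case=> ->.
- move/(congr1 size); rewrite size_cat /=.
  by have := size_leaves t1'; have := size_leaves t2'; lia.
- move/(congr1 size); rewrite size_cat /=.
  by have := size_leaves t1; have := size_leaves t2; lia.
have [w2 e2 /pos c2] := levels_climb t2.
have [w2' e2' /pos c2'] := levels_climb t2'.
move=> el; rewrite e2 e2' => ed.
have [lt|lt|es] := ltngtP (size (levels t1)) (size (levels t1')).
- by case: (main _ _ _ _ lt ed).
- by case: (main _ _ _ _ lt (esym ed)).
have [l1 l2] : leaves t1 = leaves t1' /\ leaves t2 = leaves t2'.
  have := congr1 (take (size (leaves t1))) el.
  have := congr1 (drop (size (leaves t1))) el.
  rewrite -{2 4}size_levels es size_levels.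
  by rewrite !take_size_cat // !drop_size_cat.
have [d1 d2] : levels t1 = levels t1' /\ levels t2 = levels t2'.
  have := congr1 (take (size (levels t1))) ed.
  have := congr1 (drop (size (levels t1))) ed.
  rewrite {2 4}es !take_size_cat // !drop_size_cat //.
  move=> /(inj_map succn_inj) d2.
  by rewrite e2 e2' d2.
by rewrite (h1 _ l1 d1) (h2 _ l2 d2).
Qed.

(** Appends the leaf [x] on the right, at depth [e], by walking down the right
    spine; this gives the inverse of [levels] one letter at a time. *)
Fixpoint graft t (e : nat) (x : X) : term X :=
  match t, e with
  | App t1 t2, e'.+2 => App t1 (graft t2 e'.+1 x)
  | _, _ => App t (Var x)
  end.

Lemma leaves_graft t e x : leaves (graft t e x) = rcons (leaves t) x.
Proof.
elim: t e => [y|t1 _ t2 h2] [|[|e]] //=; rewrite ?cats1 //.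
by rewrite h2 rcons_cat.
Qed.

Lemma levels_graft t e x : climbs (last 0 (levels t)) e ->
  levels (graft t e x) = rcons (levels t) e.
Proof.
elim: t e => [y|t1 _ t2 h2] [|[|e]] //=; rewrite ?cats1 //.
have [w2 e2 _] := levels_climb t2.
rewrite {1}e2 last_cat /= => c; rewrite h2 ?map_rcons ?rcons_cat // e2 /=.
by move: c; rewrite last_map /climbs; lia.
Qed.

Lemma levels_surj (s : seq X) w : size s = (size w).+1 -> path climbs 0 w ->
  exists2 t, leaves t = s & levels t = 0 :: w.
Proof.
elim/last_ind: w s => [|w e IH] s.
  by case: s => [|x []] // _ _; exists (Var x).
elim/last_ind: s => // s x _.
rewrite !size_rcons rcons_path => -[es] /andP[pw c].
have [t ls lw] := IH s es pw; exists (graft t e x).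
  by rewrite leaves_graft ls.
by rewrite levels_graft lw.
Qed.

End Levels.

(** * Depths in the tree of a term *)

Section Depth.
Variable X : eqType.
Implicit Types t : term X.

Let level t x := nth 0 (levels t) (index x (leaves t)).

Let level_App t1 t2 x : level (App t1 t2) x =
  if x \in leaves t1 then level t1 x
  else nth 0 (map succn (levels t2)) (index x (leaves t2)).
Proof.
rewrite /level /= nth_cat index_cat size_levels.
case: (x \in leaves t1) / boolP => [xt|_]; first by rewrite index_mem xt.
by rewrite ltnNge leq_addr addKn.
Qed.

Let level_AppR t1 t2 x : x \notin leaves t1 -> x \in leaves t2 ->
  level (App t1 t2) x = (level t2 x).+1.
Proof.
move=> /negbTE n1 x2; rewrite level_App n1 (nth_map 0) //.
by rewrite size_levels index_mem.
Qed.

Let level_root t : level t (leftmost t) = 0.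
Proof.
elim: t => [x|t1 h1 t2 _]; first by rewrite /level /= eqxx.
by rewrite level_App [leftmost _]/= leftmost_leaves.
Qed.

Lemma uniq_App t1 t2 : uniq (leaves (App t1 t2)) ->
  [/\ uniq (leaves t1), uniq (leaves t2)
    & forall x, x \in leaves t2 -> x \notin leaves t1].
Proof. by rewrite /= cat_uniq => /and3P[u1 /hasPn d u2]. Qed.

Let level_edge t x y : uniq (leaves t) -> tree_edge t x y ->
  level t y = (level t x).+1.
Proof.
elim: t => // t1 h1 t2 h2 /uniq_App[u1 u2 d].
rewrite tree_edge_App => /or3P[/andP[/eqP<- /eqP<-]|e|e].
- rewrite level_AppR ?d ?leftmost_leaves // level_App leftmost_leaves.
  by rewrite !level_root.
- case/andP: (tree_edge_leaves e) => xt yt.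
  by rewrite !level_App xt yt (h1 u1 e).
- case/andP: (tree_edge_leaves e) => xt yt.
  by rewrite !level_AppR ?d // (h2 u2 e).
Qed.

(** Every edge raises the level by 1, so the size of any path from the root is
    the level of its end. *)
Let depth_level t x : uniq (leaves t) -> x \in leaves t ->
  depth t x = level t x.
Proof.
move=> ut xt; rewrite /depth.
case: xgetP => [_ -> [p [pp _ <-] <-]|no]; last first.
  by have [p tp] := tree_path_exists ut xt; case: (no (size p)); exists p.
elim/last_ind: p pp => [|p y IH]; first by rewrite /= level_root.
by rewrite rcons_path last_rcons size_rcons => /andP[/IH -> /(level_edge ut)].
Qed.

Lemma depth_leftmost t : uniq (leaves t) -> depth t (leftmost t) = 0.
Proof. by move=> ut; rewrite depth_level ?leftmost_leaves ?level_root. Qed.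

Lemma depth_edge t x y : uniq (leaves t) -> tree_edge t x y ->
  depth t y = (depth t x).+1.
Proof.
move=> ut e; case/andP: (tree_edge_leaves e) => xt yt.
by rewrite !depth_level // (level_edge ut e).
Qed.

Lemma levelsE t : uniq (leaves t) -> levels t = map (depth t) (leaves t).
Proof.
move=> ut; apply: (@eq_from_nth _ 0) => [|i]; rewrite ?size_map size_levels //.
move=> il; have x0 : X by case: (leaves t) il.
by rewrite (nth_map x0) // depth_level ?mem_nth // /level index_uniq.
Qed.

(** G(t) is spanned from its root: induction along the edges reaches every
    leaf. *)
Lemma tree_ind t (P : X -> Prop) : P (leftmost t) ->
  (forall x y, tree_edge t x y -> P x -> P y) ->
  forall x, x \in leaves t -> P x.
Proof.
elim: t => [y|t1 h1 t2 h2] /=; first by move=> Py _ x; rewrite inE => /eqP->.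
move=> P1 PE x; rewrite mem_cat => /orP[]; [apply: h1|apply: h2] => //.
- by move=> y z e; apply: PE; rewrite tree_edge_App e orbT.
- by apply: PE P1; rewrite tree_edge_App !eqxx.
- by move=> y z e; apply: PE; rewrite tree_edge_App e !orbT.
Qed.

Lemma parent t y : y \in leaves t -> y != leftmost t ->
  exists x, tree_edge t x y.
Proof.
move: y; apply: tree_ind => [|x y e _ _]; first by rewrite eqxx.
by exists x.
Qed.

Lemma edge_index t x y : uniq (leaves t) -> tree_edge t x y ->
  index x (leaves t) < index y (leaves t).
Proof.
elim: t => // t1 h1 t2 h2 /uniq_App[u1 u2 d].
rewrite tree_edge_App /= !index_cat => /or3P[/andP[/eqP<- /eqP<-]|e|e].
- rewrite leftmost_leaves (negbTE (d _ (leftmost_leaves t2))).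
  by apply: ltn_addr; rewrite index_mem leftmost_leaves.
- by case/andP: (tree_edge_leaves e) => -> ->; apply: h1.
- case/andP: (tree_edge_leaves e) => /d/negbTE-> /d/negbTE->.
  by rewrite ltn_add2l h2.
Qed.

Lemma leftmostE t x0 : leftmost t = head x0 (leaves t).
Proof.
elim: t => //= t1 -> t2 _; have := size_leaves t1.
by case: (leaves t1).
Qed.

Lemma leftmost_eq t t' : leaves t = leaves t' -> leftmost t = leftmost t'.
Proof.
move=> el; pose x0 := leftmost t.
by rewrite (leftmostE t x0) (leftmostE t' x0) el.
Qed.

End Depth.

(** * Identities and tree homomorphisms *)

Section Homs.
Variables (V : Type) (E : V -> V -> Prop) (X : eqType).
Implicit Types (t : term X) (f : X -> V).

Definition tree_hom t f : Prop := forall x y, tree_edge t x y -> E (f x) (f y).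

Lemma tree_hom_App t1 t2 f : tree_hom (App t1 t2) f <->
  [/\ E (f (leftmost t1)) (f (leftmost t2)), tree_hom t1 f & tree_hom t2 f].
Proof.
split=> [h|[h h1 h2] x y].
  by split=> [|x y e|x y e]; apply: h; rewrite tree_edge_App ?e ?eqxx ?orbT.
by rewrite tree_edge_App => /or3P[/andP[/eqP<- /eqP<-]|/h1|/h2].
Qed.

Lemma eval_total t f (a : X -> option V) :
  (forall x, x \in leaves t -> a x = Some (f x)) ->
  eval (graph_mul E) t a =
  if `[< tree_hom t f >] then Some (f (leftmost t)) else None.
Proof.
elim: t => [x|t1 h1 t2 h2] af /=.
  by rewrite asboolT ?af //= inE.
rewrite h1 ?h2 => [|x xt|x xt]; try by rewrite af //= mem_cat xt ?orbT.
have [h|nh] := asboolP (tree_hom (App t1 t2) f).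
  case/tree_hom_App: h => e e1 e2.
  by rewrite (asboolT e1) (asboolT e2) /= (asboolT e).
case: asboolP => e1; case: asboolP => e2 //=; case: asboolP => // e.
by case: nh; apply/tree_hom_App.
Qed.

Lemma eval_None t (a : X -> option V) x : x \in leaves t -> a x = None ->
  eval (graph_mul E) t a = None.
Proof.
move=> + ax; elim: t => [y|t1 h1 t2 h2] /=; first by rewrite inE => /eqP<-.
by rewrite mem_cat => /orP[/h1|/h2] -> //; case: (eval _ _ _).
Qed.

Lemma satisfies_tree_hom t t' : leaves t = leaves t' ->
  satisfies (graph_mul E) t t' <-> (forall f, tree_hom t f <-> tree_hom t' f).
Proof.
move=> el; have er := leftmost_eq el.
split=> [sat f|hom a].
  have /= := sat (Some \o f); rewrite !(@eval_total _ f) //.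
  by do 2!case: asboolP.
have [[x xt ax]|some] := pselect (exists2 x, x \in leaves t & a x = None).
  by rewrite !(eval_None _ ax) -?el.
have v0 : V.
  case av: (a (leftmost t)) => [v|]; first exact: v.
  by case: some; exists (leftmost t) => //; exact: leftmost_leaves.
pose f x := odflt v0 (a x).
have af x : x \in leaves t -> a x = Some (f x).
  by rewrite /f => xt; case ax: (a x) => //; case: some; exists x.
by rewrite !(@eval_total _ f) -?el // er (asbool_equiv_eq (hom f)).
Qed.

End Homs.

(** * Graphs in which walks of length 3 close up *)

Section GraphTypes.
Variables (V : Type) (E : V -> V -> Prop).
Hypothesis symE : undirected E.

Definition three_closed : Prop :=
  forall u v w z, E u v -> E v w -> E w z -> E u z.

Let comp u : set V := [set v | reachable E u v /\ reachable E v u]%classic.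

Let compP u : component E (comp u).
Proof. by exists u. Qed.

Let comp0 u : comp u u.
Proof. by split; exists [::]. Qed.

Lemma reachable_rcons u v w : reachable E u v -> E v w -> reachable E u w.
Proof.
move=> [p [pp lp]] e; exists (rcons p w); rewrite last_rcons; split=> //.
elim: p u pp lp => [|x p IH] u /= => [_ ->//|[ux pp] lp].
by split=> //; apply: IH.
Qed.

Let compE u v w : comp u v -> E v w -> comp u w.
Proof.
move=> [uv [p [pp lp]]] e; split; first exact: reachable_rcons e.
by exists (v :: p) => /=; split=> //; split=> //; apply: symE.
Qed.

Let nontrivial u v w : comp u v -> E v w -> ~ trivial_graph E (comp u).
Proof. by move=> uv e [_ /(_ v w uv (compE uv e))]. Qed.

Lemma trivial_or_complete_trans : components_trivial_or_complete E ->
  forall u v w, E u v -> E v w -> E u w.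
Proof.
move=> tc u v w uv vw; case: (tc _ (compP u)).
  by move/nontrivial => /(_ _ _ (comp0 u) uv).
have v1 := compE (comp0 u) uv; have w1 := compE v1 vw.
by apply.
Qed.

Lemma bipartite_three_closed : components_with_bipartite E -> three_closed.
Proof.
move=> [tcb _] u v w z uv vw wz.
have u1 := comp0 u; have v1 := compE u1 uv; have w1 := compE v1 vw.
have z1 := compE w1 wz.
case: (tcb _ (compP u)) => [|/(_ u z)|[B1 [B2 [_ _ d _ EB]]]]; last 2 first.
- exact.
- have D x : B1 x -> B2 x -> False.
    by move=> b1 b2; have : (B1 `&` B2)%classic x by []; rewrite d.
  apply/(EB _ _ u1 z1); move: uv vw wz => /(EB _ _ u1 v1) uv /(EB _ _ v1 w1) vw.
  move=> /(EB _ _ w1 z1) wz.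
  (* The sides alternate along the walk, so [u] and [z] lie on opposite sides;
     in the other cases [v] or [w] would lie on both. *)
  case: uv => -[a b]; case: vw => -[c d']; case: wz => -[e g];
    (try by left); (try by right); exfalso;
    by first [exact: (D v) | exact: (D w)].
- by move/nontrivial => /(_ _ _ u1 uv).
Qed.

Lemma bipartite_edge : components_with_bipartite E ->
  exists u v, E u v /\ ~ E u u.
Proof.
move=> [_ [C [_ [B1 [B2 [[u u1] [v v2] d <- EB]]]]]]; exists u, v.
have uC : (B1 `|` B2)%classic u by left.
have vC : (B1 `|` B2)%classic v by right.
split; first by apply/EB => //; left.
have D x : B1 x -> B2 x -> False.
  by move=> b1 b2; have : (B1 `&` B2)%classic x by []; rewrite d.
by move/(EB _ _ uC uC) => [] []; [move=> _|]; [|move=> + _]; apply: D.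
Qed.

(** If [u] has a loop, adjacency to [u] spreads along edges, so the component is
    complete.  If [u] is loopless with a neighbour [v], the neighbours of [v]
    and those of [u] are the two sides of a complete bipartite graph: a common
    neighbour [x] would give the walk u, x, v, u and hence a loop at [u]. *)
Lemma three_closed_component u : three_closed ->
  [\/ trivial_graph E (comp u), complete_graph E (comp u)
    | complete_bipartite_graph E (comp u)].
Proof.
move=> E3.
have [[v uv]|iso] := pselect (exists v, E u v); last first.
  apply: Or31; have eC : comp u = [set u]%classic.
    apply/seteqP; split=> [x /= [[[|v p] [/=]]]|x ->]; last exact: comp0.
      by move=> _ ->.
    by move=> [uv _]; case: iso; exists v.
  by rewrite eC; split=> [|x y -> -> uu]; [exists u|apply: iso; exists u].
have closed (P : V -> Prop) : P u -> (forall x y, E x y -> P x -> P y) ->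
    forall x, comp u x -> P x.
  move=> Pu PE x [[p [pp <-]] _].
  elim: p u Pu pp {uv} => //= y p IH z Pz [zy pp].
  exact: IH (PE _ _ zy Pz) pp.
have [uu|nuu] := pselect (E u u).
  apply: Or32 => x y.
  have adj z : comp u z -> E u z.
    by move: z; apply: closed => // a b ab ua; exact: E3 uu ua ab.
  by move=> /adj/symE xu /adj uy; exact: E3 xu uu uy.
apply: Or33.
pose B1 := [set x | E v x]%classic; pose B2 := [set x | E u x]%classic.
have cross12 x y : E x y -> B1 x -> B2 y by move=> xy vx; exact: E3 uv vx xy.
have cross21 x y : E x y -> B2 x -> B1 y.
  by move=> xy ux; exact: E3 (symE uv) ux xy.
have sides : forall x, comp u x -> (B1 `|` B2)%classic x.
  apply: closed => [|x y xy [/(cross12 _ _ xy)|/(cross21 _ _ xy)]].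
  - by left; exact: symE.
  - by right.
  - by left.
exists B1, B2; split.
- by exists u; apply: symE.
- by exists v.
- apply/seteqP; split=> // x [/= vx ux].
  by apply: nuu; exact: E3 ux (symE vx) (symE uv).
- apply/seteqP; split=> [x [/= vx|/= ux]|].
  + exact: compE (compE (comp0 u) uv) vx.
  + exact: compE (comp0 u) ux.
  exact: sides.
move=> x y xC _; split=> [xy|[[vx uy]|[ux vy]]].
- have := sides x xC.
  case=> [b1|b2]; [left|right]; split=> //.
    exact: cross12 xy b1.
  exact: cross21 xy b2.
- exact: E3 (symE vx) (symE uv) uy.
- exact: E3 (symE ux) uv vy.
Qed.

Lemma three_closed_cases : three_closed ->
  components_trivial_or_complete E \/ components_with_bipartite E.
Proof.
move=> E3.
have [bip|nobip] :=
  pselect (exists C, component E C /\ complete_bipartite_graph E C).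
  by right; split=> // C [u ->]; exact: three_closed_component.
left=> C cC; have [u eC] := cC.
have := three_closed_component u E3; rewrite /comp -eC => -[h|h|h].
- by left.
- by right.
by case: nobip; exists C.
Qed.

Definition endless (g : nat -> V) : Prop := forall j, E (g j) (g j.+1).

(** A walk of length 3 with nonadjacent ends also yields one of length 2: if u
    and w are adjacent take u, w, z, and otherwise u, v, w.  Going back and
    forth on the first edge then adds 2 to the length at a time, so every
    length from 2 on occurs. *)
Let nonadjacent_start k : ~ three_closed ->
  exists g, endless g /\ ~ E (g 0) (g k.+2).
Proof.
move=> /existsNP[u /existsNP[v /existsNP[w /existsNP[z]]]].
move=> /not_implyP[uv /not_implyP[vw /not_implyP[wz nuz]]].
have osc x y : E x y -> endless (fun j => if odd j then y else x).
  by move=> xy j /=; case: odd => //=; exact: symE.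
have cons x g : E x (g 0) -> endless g ->
    endless (fun j => if j is i.+1 then g i else x).
  by move=> xg gg [].
have [m] := ubnP k; elim: m k => // m IH [|[|k]] km.
- have [p [q [r [pq qr npr]]]] : exists p q r, [/\ E p q, E q r & ~ E p r].
    have [uw|nuw] := pselect (E u w); first by exists u, w, z.
    by exists u, v, w.
  exists (fun j => if j is i.+1 then if odd i then r else q else p).
  by split=> //; apply: (cons p _ _ (osc q r qr)).
- exists (fun j => if j is i.+1 then
                   (if i is l.+1 then if odd l then z else w else v) else u).
  by split=> //; apply: (cons u _ _ (cons v _ _ (osc w z wz))).
have [g [gg ng]] := IH k (ltnW km).
exists (fun j => if j is i.+1 then (if i is l.+1 then g l else g 1) else g 0).
by split=> //; apply: (cons _ _ _ (cons (g 1) _ _ gg)) => //; exact: symE.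
Qed.

(** Vertices before position [a] are filled in by going back and forth on the
    first edge of the walk. *)
Lemma nonadjacent_endless a b : ~ three_closed -> a.+1 < b ->
  exists g, endless g /\ ~ E (g a) (g b).
Proof.
move=> nE3; elim: a b => [|a IH] [|[|b]] // ab; first exact: nonadjacent_start.
have [g [gg ng]] := IH b.+1 ab.
exists (fun j => if j is i.+1 then g i else g 1); split=> // -[|j] //=.
exact: symE.
Qed.

End GraphTypes.

(** * Homomorphisms of two trees on the same leaves *)

Section Identities.
Variables (V : Type) (E : V -> V -> Prop) (X : eqType).
Hypothesis symE : undirected E.
Implicit Types (t : term X) (f : X -> V).

Lemma tree_hom_trans t t' f : uniq (leaves t) -> leaves t = leaves t' ->
  (forall u v w, E u v -> E v w -> E u w) -> tree_hom E t f -> tree_hom E t' f.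
Proof.
move=> ut el trE hom.
have er := leftmost_eq el.
have adj : forall x, x \in leaves t ->
    x = leftmost t \/ E (f (leftmost t)) (f x).
  apply: tree_ind; first by left.
  by move=> x y /hom xy [<- //|rx]; right=> //; exact: trE rx xy.
move=> x y e; case/andP: (tree_edge_leaves e); rewrite -el => /adj xr /adj yr.
have ry : E (f (leftmost t)) (f y).
  case: yr e => // ->; rewrite er.
  by rewrite (negbTE (tree_edge_root x _)) // -el.
by case: xr => [->//|rx]; exact: trE (symE rx) ry.
Qed.

(** Seen from the image of the root, vertices of odd depth are neighbours and
    vertices of even depth are twins: they have the same neighbours as the
    image of the root.  As the parities agree, an edge of G(t') joins a vertex
    of odd depth in G(t) to one of even depth. *)
Lemma tree_hom_parity t t' f : uniq (leaves t) -> leaves t = leaves t' ->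
  three_closed E ->
  (forall x, x \in leaves t -> odd (depth t x) = odd (depth t' x)) ->
  tree_hom E t f -> tree_hom E t' f.
Proof.
move=> ut el E3 par hom; set r := leftmost t.
have side : forall x, x \in leaves t ->
    if odd (depth t x) then E (f r) (f x)
    else forall z, E (f r) z <-> E (f x) z.
  apply: tree_ind => [|x y e]; first by rewrite depth_leftmost.
  rewrite (depth_edge ut e) /=; have xy := hom _ _ e.
  case: odd => /= [rx z|twin]; last exact/twin.
  split=> [rz|yz]; first exact: E3 (symE xy) (symE rx) rz.
  exact: E3 rx xy yz.
move=> x y e; case/andP: (tree_edge_leaves e); rewrite -el => xt yt.
have := side x xt; have := side y yt.
rewrite !par // (depth_edge _ e) -?el //=; case: odd => /=.
  by move=> yr rx; exact/symE/yr.
by move=> ry twin; exact/twin.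
Qed.

(** Colouring the vertices with [u] and [v] by the parity of their depth in
    G(t) is a homomorphism; as a homomorphism from G(t') it must alternate
    along the edges of G(t'), because neither [u] nor [v] has a loop. *)
Lemma parity_of_tree_hom t t' u v : uniq (leaves t) -> leaves t = leaves t' ->
  three_closed E -> E u v -> ~ E u u ->
  (forall f, tree_hom E t f -> tree_hom E t' f) ->
  forall x, x \in leaves t -> odd (depth t x) = odd (depth t' x).
Proof.
move=> ut el E3 uv nuu hom.
have nvv : ~ E v v by move=> vv; apply: nuu; exact: E3 uv vv (symE uv).
pose f x := if odd (depth t x) then v else u.
have /hom hf : tree_hom E t f.
  move=> x y e; rewrite /f (depth_edge ut e) /=.
  by case: odd => //=; exact: symE.
rewrite el; apply: tree_ind => [|x y e].
  by rewrite -{1}(leftmost_eq el) !depth_leftmost -?el.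
rewrite (depth_edge _ e) -?el //= => <-.
by have := hf _ _ e; rewrite /f; do 2!case: odd.
Qed.

(** At the first leaf where the depths differ, the tree with the larger depth
    has a homomorphism, constant on each level, that is not one of the other
    tree. *)
Lemma depth_of_tree_hom t t' : uniq (leaves t) -> leaves t = leaves t' ->
  ~ three_closed E -> (forall f, tree_hom E t f <-> tree_hom E t' f) ->
  forall x, x \in leaves t -> depth t x = depth t' x.
Proof.
move=> ut el nE3 hom.
have step t1 t2 y : uniq (leaves t1) -> leaves t1 = leaves t2 ->
    (forall f, tree_hom E t1 f -> tree_hom E t2 f) -> y \in leaves t1 ->
    (forall x, x \in leaves t1 -> index x (leaves t1) < index y (leaves t1) ->
       depth t1 x = depth t2 x) ->
    depth t1 y <= depth t2 y.
  move=> u1 el12 hom12 y1 below; rewrite leqNgt; apply/negP => lt.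
  have [yr|yr] := eqVneq y (leftmost t2).
    by rewrite yr -(leftmost_eq el12) depth_leftmost in lt.
  have [|x e] := parent _ yr; first by rewrite -el12.
  have u2 : uniq (leaves t2) by rewrite -el12.
  case/andP: (tree_edge_leaves e) => x2 _.
  have dx : depth t1 x = depth t2 x.
    by apply: below; rewrite el12 // edge_index.
  rewrite (depth_edge u2 e) -dx in lt.
  have [g [gE]] := nonadjacent_endless symE nE3 lt; apply.
  apply: (hom12 (fun z => g (depth t1 z))) e => z w e.
  by rewrite (depth_edge u1 e).
(* Applied both ways, [step] gives the two inequalities between the depths. *)
move=> x; have [m] := ubnP (index x (leaves t)).
elim: m x => // m IH x lem xt; apply/eqP; rewrite eqn_leq.
apply/andP; split; apply: step; rewrite -?el //; try by move=> f /hom.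
  by move=> y yt lt; apply: IH => //; exact: leq_trans lt _.
by move=> y yt lt; apply/esym/IH => //; exact: leq_trans lt _.
Qed.

End Identities.

(** * Counting depth words *)

Section Counting.

(** The words of length [m] that may follow a letter [d] in a depth word, see
    [mem_climb_words]. *)
Fixpoint climb_words (m d : nat) : seq (seq nat) :=
  if m is m'.+1 then [seq e :: w | e <- iota 1 d.+1, w <- climb_words m' e]
  else [:: [::]].

Lemma climb_wordsS m d : climb_words m.+1 d =
  [seq e :: w | e <- iota 1 d.+1, w <- climb_words m e].
Proof. by []. Qed.

Lemma mem_climb_words m d w :
  (w \in climb_words m d) = (size w == m) && path climbs d w.
Proof.
elim: m d w => [|m IH] d w; first by case: w.
rewrite climb_wordsS; apply/allpairsPdep/idP => [[e [y [ed yw ->]]]|].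
  by move: yw ed; rewrite IH mem_iota /= eqSS => /andP[-> ->]; rewrite andbT.
case: w => // e w /and3P[sw c pw]; exists e, w.
by split=> //; [rewrite mem_iota|rewrite IH -eqSS; apply/andP].
Qed.

Lemma uniq_climb_words m d : uniq (climb_words m d).
Proof.
elim: m d => [//|m IH] d; rewrite climb_wordsS.
apply: allpairs_uniq_dep; rewrite ?iota_uniq //.
by move=> -[a b] [a' b'] _ _ /= [-> ->].
Qed.

Lemma size_climb_words_from0 m :
  size (climb_words m.+1 0) = size (climb_words m 1).
Proof. by rewrite climb_wordsS size_allpairs_dep /= addn0. Qed.

Lemma size_climb_wordsS m d : size (climb_words m.+1 d.+1) =
  size (climb_words m.+1 d) + size (climb_words m d.+2).
Proof.
rewrite !climb_wordsS !size_allpairs_dep -(addn1 d.+1) iotaD map_cat sumn_cat.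
by rewrite /= addn0 (addnC 1).
Qed.

(** The ballot numbers: the recurrences of the two preceding lemmas match
    Pascal's rule.  Since 'C(N, m) is moved to the left-hand side, no truncated
    subtraction occurs. *)
Lemma size_climb_words m d :
  size (climb_words m.+1 d) + 'C(m.*2 + d.+2, m) = 'C(m.*2 + d.+2, m.+1).
Proof.
elim: m d => [|m IH] d.
  rewrite bin0 bin1; elim: d => [|d IHd] //.
  by rewrite size_climb_wordsS [climb_words 0 _]/= [size [:: _]]/=; lia.
elim: d => [|d IHd].
  have := IH 1; rewrite (size_climb_words_from0 m.+1).
  have -> : m.*2.+2 + 2 = (m.*2 + 3).+1 by lia.
  have sym : 'C(m.*2 + 3, m.+2) = 'C(m.*2 + 3, m.+1).
    by rewrite -[LHS]bin_sub; [congr 'C(_, _)|]; lia.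
  by rewrite !binS sym; lia.
rewrite size_climb_wordsS; have := IH d.+2; move: IHd.
have -> : m.+1.*2 + d.+2 = m.*2 + d.+4 by lia.
have -> : m.+1.*2 + d.+3 = (m.*2 + d.+4).+1 by lia.
by rewrite !binS; lia.
Qed.

Lemma size_climb_words0 m : size (climb_words m 0) = catalan m.
Proof.
case: m => [//|m]; rewrite /catalan.
have -> : m.+1.*2 = m.*2 + 2 by lia.
have := size_climb_words m 0; have := mul_bin_left (m.*2 + 2) m.
set N := size _; set a := 'C(_, m); set b := 'C(_, m.+1) => ab Nab.
have -> : b = N * m.+2 by nia.
by rewrite mulnK.
Qed.

(** If [key] classifies the bracketings up to the identities of [op], the
    induced operations correspond to the values of [key]. *)
Lemma assoc_spectrum_size (A : Type) (op : A -> A -> A) n (K : eqType)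
    (key : term 'I_n -> K) (S : seq K) :
  0 < n -> uniq S ->
  (forall t, bracketings t -> key t \in S) ->
  (forall k, k \in S -> exists2 t, bracketings t & key t = k) ->
  (forall t t', bracketings t -> bracketings t' ->
     satisfies op t t' <-> key t = key t') ->
  assoc_spectrum op n = size S.
Proof.
move=> n0 uS keyS Skey sat.
have /choice[rep repP] : forall k, exists t : term 'I_n,
    k \in S -> bracketings t /\ key t = k.
  move=> k; have [/Skey[t bt kt]|_] := boolP (k \in S); first by exists t.
  by exists (Var (Ordinal n0)).
pose F k : {classic ('I_n -> A) -> A} := eval op (rep k).
have uF : uniq (map F S).
  rewrite map_inj_in_uniq // => k k' /repP[b kk] /repP[b' kk'] eF.
  rewrite -kk -kk'; apply/sat => // a.
  exact: (congr1 (fun h : ('I_n -> A) -> A => h a) eF).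
rewrite /assoc_spectrum -(size_map F S) -(undup_id uF) -card_fseq.
congr (#|` _|)%fset; rewrite -[RHS]set_fsetK; congr fset_set.
apply/seteqP; split=> [_ [t bt <-]|g] /=.
  rewrite !inE; apply/mapP; exists (key t); first exact: keyS.
  have [b k] := repP _ (keyS t bt); apply/funext => a.
  by have /sat -> := esym k.
rewrite !inE => /mapP[k /repP[b kk] ->].
by exists (rep k).
Qed.

End Counting.

(** * Bracketings *)

Section Bracketings.
Variable n : nat.
Implicit Types t : term 'I_n.

Lemma bracketings_eq_leaves t t' : bracketings t -> bracketings t' ->
  uniq (leaves t) /\ leaves t = leaves t'.
Proof. by move=> -> ->; rewrite enum_uniq. Qed.

Lemma mem_bracketings t i : bracketings t -> i \in leaves t.
Proof. by move=> ->; rewrite mem_enum. Qed.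

Lemma bracketings_levels t : 0 < n -> bracketings t ->
  exists2 w, levels t = 0 :: w & w \in climb_words n.-1 0.
Proof.
move=> n0 bt; have [w lt c] := levels_climb t; exists w => //.
rewrite mem_climb_words c andbT -eqSS prednK //.
by have := size_levels t; rewrite lt bt size_enum_ord => /eqP.
Qed.

Lemma levels_bracketings w : 0 < n -> w \in climb_words n.-1 0 ->
  exists2 t : term 'I_n, bracketings t & levels t = 0 :: w.
Proof.
move=> n0; rewrite mem_climb_words => /andP[/eqP sw c].
by apply: levels_surj => //; rewrite size_enum_ord sw prednK.
Qed.

Lemma eq_map_levels (K : eqType) (h : nat -> K) t t' :
  bracketings t -> bracketings t' ->
  map h (levels t) = map h (levels t') <->
  forall i, h (depth t i) = h (depth t' i).
Proof.
move=> bt bt'; have [ut el] := bracketings_eq_leaves bt bt'.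
rewrite !levelsE -?el // -!map_comp; split=> [/eq_in_map e i|e].
  by apply: e; exact: mem_bracketings.
by apply/eq_in_map => i _; exact: e.
Qed.

Lemma bracketings_nonempty : 0 < n -> exists t : term 'I_n, bracketings t.
Proof.
(* The left-nested bracketing, where all other leaves are children of x_1. *)
move=> n0.
suff /(levels_bracketings n0)[t bt _] : nseq n.-1 1 \in climb_words n.-1 0.
  by exists t.
rewrite mem_climb_words size_nseq eqxx /=.
suff: forall m d, path climbs d (nseq m 1) by apply.
by elim=> //= m IH d; rewrite IH.
Qed.

(** The depth of x_2 is always 1, and the later parities are free. *)
Definition parity_words (m : nat) : seq (seq bool) :=
  [seq [:: false, true & tval b] | b <- enum {: m.-tuple bool}].

Lemma size_parity_words m : size (parity_words m) = 2 ^ m.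
Proof. by rewrite size_map -cardE card_tuple card_bool. Qed.

Lemma uniq_parity_words m : uniq (parity_words m).
Proof. by rewrite map_inj_uniq ?enum_uniq // => b b' [/val_inj]. Qed.

Lemma mem_parity_words m w :
  ([:: false, true & w] \in parity_words m) = (size w == m).
Proof.
apply/mapP/idP => [[b _ [->]]|sw]; first by rewrite size_tuple.
by exists (Tuple sw); rewrite ?mem_enum.
Qed.

Lemma bracketings_parity t : 1 < n -> bracketings t ->
  map odd (levels t) \in parity_words (n - 2).
Proof.
move=> n1 bt; have [w ->] := bracketings_levels (ltnW n1) bt.
rewrite mem_climb_words => /andP[/eqP sw].
case: w sw => [|[|[|e]] w] //=; first by lia.
by move=> sw _; rewrite mem_parity_words size_map; lia.
Qed.

Lemma parity_bracketings k : 1 < n -> k \in parity_words (n - 2) ->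
  exists2 t : term 'I_n, bracketings t & map odd (levels t) = k.
Proof.
move=> n1 /mapP[b _ ->]; pose low (c : bool) := if c then 1 else 2.
have [|t bt lt] := @levels_bracketings (1 :: map low b) (ltnW n1).
  rewrite mem_climb_words /= size_map size_tuple.
  apply/andP; split; first by lia.
  (* The letters 1 and 2 may follow every positive letter. *)
  suff: forall s d, 0 < d -> path climbs d (map low s) by apply.
  by elim=> //= c s IH d d0; case: c; rewrite IH // /climbs /=; lia.
exists t; rewrite // lt /= -map_comp; congr [:: _, _ & _].
by rewrite -[RHS]map_id; apply: eq_map => -[].
Qed.

End Bracketings.

Theorem theorem3p3 (V : Type) (E : V -> V -> Prop) :
  inhabited V -> undirected E ->
  [/\ components_trivial_or_complete E ->
      (forall n (t t' : term 'I_n),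
         bracketings t -> bracketings t' -> satisfies (graph_mul E) t t') /\
      (forall n, 1 <= n -> assoc_spectrum (graph_mul E) n = 1),
      components_with_bipartite E ->
      (forall n (t t' : term 'I_n), 1 <= n ->
         bracketings t -> bracketings t' ->
         (satisfies (graph_mul E) t t' <->
          forall i : 'I_n, depth t i = depth t' i %[mod 2])) /\
      (forall n, 2 <= n -> assoc_spectrum (graph_mul E) n = 2 ^ (n - 2)) &
      ~ components_trivial_or_complete E -> ~ components_with_bipartite E ->
      (forall n (t t' : term 'I_n),
         bracketings t -> bracketings t' ->
         satisfies (graph_mul E) t t' -> t = t') /\
      (forall n, 1 <= n -> assoc_spectrum (graph_mul E) n = catalan (n - 1))].
Proof.
move=> _ symE; split.
- move=> /(trivial_or_complete_trans symE) trE.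
  have sat n (t t' : term 'I_n) :
      bracketings t -> bracketings t' -> satisfies (graph_mul E) t t'.
    move=> bt bt'; have [ut el] := bracketings_eq_leaves bt bt'.
    apply/satisfies_tree_hom => // f.
    by split; apply: tree_hom_trans; rewrite -?el.
  split=> // n n0; pose key (t : term 'I_n) := tt.
  rewrite (@assoc_spectrum_size _ _ _ _ key [:: tt]) //.
    by move=> [] _; have [t bt] := bracketings_nonempty n0; exists t.
  by move=> t t' bt bt'; split=> // _; exact: sat.
- move=> bip; have E3 := bipartite_three_closed symE bip.
  have [u [v [uv nuu]]] := bipartite_edge bip.
  have sat n (t t' : term 'I_n) : bracketings t -> bracketings t' ->
      satisfies (graph_mul E) t t' <->
      forall i, odd (depth t i) = odd (depth t' i).
    move=> bt bt'; have [ut el] := bracketings_eq_leaves bt bt'.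
    rewrite (satisfies_tree_hom E el); split=> [hom i|par f].
      apply: (parity_of_tree_hom symE ut el E3 uv nuu) => [f /hom //|].
      exact: mem_bracketings.
    by split; apply: tree_hom_parity; rewrite -?el.
  split=> [n t t' _ bt bt'|n n2].
    rewrite (sat _ _ _ bt bt'); split=> par i; have := par i.
      by rewrite !modn2 => ->.
    by rewrite !modn2; do 2!case: odd.
  rewrite (@assoc_spectrum_size _ _ _ _ (fun t => map odd (levels t))
             (parity_words (n - 2))) ?size_parity_words ?uniq_parity_words //.
  + exact: ltnW.
  + by move=> t bt; exact: bracketings_parity.
  + by move=> w; exact: parity_bracketings.
  by move=> t t' bt bt'; rewrite sat // eq_map_levels.
move=> ntc nbip.
have nE3 : ~ three_closed E by move/(three_closed_cases symE) => -[].
have sat n (t t' : term 'I_n) : bracketings t -> bracketings t' ->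
    satisfies (graph_mul E) t t' -> t = t'.
  move=> bt bt'; have [ut el] := bracketings_eq_leaves bt bt'.
  move/(satisfies_tree_hom E el) => hom; apply: (levels_inj el).
  rewrite -(map_id (levels t)) -(map_id (levels t')).
  apply/eq_map_levels => // i.
  by apply: (depth_of_tree_hom symE ut el nE3 hom); exact: mem_bracketings.
split=> // n n0; rewrite subn1 -size_climb_words0.
rewrite (@assoc_spectrum_size _ _ _ _ (fun t => behead (levels t))
           (climb_words n.-1 0)) //.
- exact: uniq_climb_words.
- by move=> t bt; have [w ->] := bracketings_levels n0 bt.
- by move=> w /(levels_bracketings n0)[t bt lt]; exists t; rewrite // lt.
move=> t t' bt bt'; split=> [/sat ->//|].
have [w lw _] := bracketings_levels n0 bt.
have [w' lw' _] := bracketings_levels n0 bt'.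
have [_ el] := bracketings_eq_leaves bt bt'.
rewrite lw lw' /= => ew; rewrite (@levels_inj _ t t') //.
by rewrite lw lw' ew.
Qed.
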